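(* In the setting described in the context, assume that $x_k\to x_*\in\mathbb{R}^n$, that $W_k\to W_*$ for some nonsingular $W_*\in\mathbb{R}^{n\times n}$, and that the steps are uniformly linearly independent in the following sense: there exist $m\in\mathbb{N}$ and $c\in[0,1)$ such that for all sufficiently large $k_0$, $\left\| \prod_{k=k_0}^{k_0+m-1}\left( I - \frac{W_*^{-1}s_ks_k^TW_*^{-T}}{s_k^TW_*^{-T}W_*^{-1}s_k}\right)\right\|_2 \le c$. Then $\mathcal{C}_k\to D^pf(x_* )$ as $k\to\infty$.
   Context: Setting (higher-order secant update): $p\ge 2$; $f:\mathbb{R}^n\to\mathbb{R}$ is $p$ times continuously differentiable, $D^pf(x)$ denoting its $p$th derivative viewed as a symmetric multilinear map; $(x_k)_{k\ge0}$ is a sequence in $\mathbb{R}^n$ with steps $s_k = x_{k+1}-x_k \ne 0$; $(W_k)_{k\ge0}$ are nonsingular $n\times n$ matrices; $\widetilde{\mathcal{C}}_k = \int_0^1 D^pf(x_k+ts_k)\,dt$; $\mathcal{C}_0\in\mathbb{R}^{\otimes^p n}_{\mathrm{sym}}$ is arbitrary and $\mathcal{C}_{k+1}$ is the unique minimizer of $\|(\mathcal{C}-\mathcal{C}_k)[W_k]^p\|_F$ over $\mathcal{C}\in\mathbb{R}^{\otimes^p n}_{\mathrm{sym}}$ subject to $\mathcal{C}[s_k]=\widetilde{\mathcal{C}}_k[s_k]$. Notation: a $p$-tensor is a multilinear map $(\mathbb{R}^n)^p\to\mathbb{R}$; $\mathcal{T}[s]$ fixes the first argument to $s$; $(\mathcal{T}[M]^p)[s_1,\dots,s_p]=\mathcal{T}[Ms_1,\dots,Ms_p]$;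 symmetric means invariant under permutation of arguments; $\|\cdot\|_F$ is the Frobenius norm of the array of entries; $\|\cdot\|_2$ on matrices is the spectral norm. *)

(* Defs.v *)
From HB Require Import structures.
From mathcomp Require Import all_boot all_order all_algebra all_fingroup.
From mathcomp Require Import all_classical all_reals all_analysis.
Set Implicit Arguments. Unset Strict Implicit. Unset Printing Implicit Defensive.
Import Order.TTheory GRing.Theory Num.Theory.
Import numFieldNormedType.Exports.
Local Open Scope ring_scope.
Local Open Scope classical_set_scope.

Section Defs.
Variables (R : realType) (n p : nat).

Notation vec := 'cV[R]_n.

Definition tensor := {ffun 'I_p -> 'I_n} -> R.

Definition teval (T : tensor) (v : 'I_p -> vec) : R :=
  \sum_(idx : {ffun 'I_p -> 'I_n}) T idx * \prod_(j < p) v j (idx j) 0.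

Definition tsym (T : tensor) : Prop :=
  forall (sigma : 'S_p) (idx : {ffun 'I_p -> 'I_n}),
    T [ffun j => idx (sigma j)] = T idx.

(* T[s] = U[s] as (p-1)-tensors: agreement for every choice of the
   remaining p-1 arguments, the first argument being fixed to s *)
Definition fix_first (s : vec) (v : 'I_p -> vec) : 'I_p -> vec :=
  fun j => if val j == 0%N then s else v j.
Definition tcontr_eq (T U : tensor) (s : vec) : Prop :=
  forall v : 'I_p -> vec, teval T (fix_first s v) = teval U (fix_first s v).

(* (T[M]^p)[s_1..s_p] = T[M s_1, ..., M s_p] *)
Definition tcongr (T : tensor) (M : 'M[R]_n) : tensor :=
  fun idx => teval T (fun j => col (idx j) M).

Definition tsub (T U : tensor) : tensor := fun idx => T idx - U idx.

Definition frob (T : tensor) : R :=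
  Num.sqrt (\sum_(idx : {ffun 'I_p -> 'I_n}) T idx ^+ 2).

Definition evec (i : 'I_n) : vec := delta_mx i 0.

Fixpoint iterD (f : vec -> R) (l : seq 'I_n) : vec -> R :=
  match l with
  | [::] => f
  | i :: l' => fun x => 'D_(evec i) (iterD f l') x
  end.

Definition Cp (f : vec -> R) : Prop :=
  (forall l : seq 'I_n, (size l < p)%N ->
     forall (i : 'I_n) (x : vec), derivable (iterD f l) x (evec i)) /\
  (forall l : seq 'I_n, (size l <= p)%N -> continuous (iterD f l)).

Definition Dp (f : vec -> R) (x : vec) : tensor :=
  fun idx => iterD f [seq idx j | j <- enum 'I_p] x.

Definition Dp_avg (f : vec -> R) (x s : vec) : tensor :=
  fun idx => Rintegral (@lebesgue_measure R) `[0, 1]%classic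
                       (fun t => Dp f (x + t *: s) idx).

Definition euclid (x : vec) : R := Num.sqrt (\sum_i x i 0 ^+ 2).
Definition spec_norm (A : 'M[R]_n) : R :=
  sup [set euclid (A *m x) | x in [set x : vec | euclid x <= 1]].

Definition proj_factor (W : 'M[R]_n) (s : vec) : 'M[R]_n :=
  1%:M - ((s^T *m (invmx W)^T *m invmx W *m s) 0 0)^-1 *:
          (invmx W *m s *m s^T *m (invmx W)^T).

Definition mxprod (A : nat -> 'M[R]_n) (k0 m : nat) : 'M[R]_n :=
  foldr (fun k P => A k *m P) 1%:M (iota k0 m).

End Defs.

(* Main.v *)
(* Let D_k be the averaged derivative, u_k the unit vector along W_k^-1 s_k and
   M_k = W_k (I - u_k u_k^T) W_k^-1 = I - s_k w_k^T.  Minimality gives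
   (C_{k+1} - C_k)[M_k]^p = 0, because congruence by I - u_k u_k^T is the
   orthogonal projection of the symmetric tensors onto those killed by u_k.  As
   C_{k+1} - D_k is symmetric (Schwarz's theorem for D_k) and killed by s_k, it
   is fixed by the congruence by M_k, so
     C_{k+1} - D_k = (C_k - D_k)[M_k]^p.
   In the coordinates F_k = (C_k - D^p f(xs))[Ws]^p this reads
   F_{k+1} = F_k[N_k]^p + o(1), where N_k = Ws^-1 M_k Ws differs from the
   projection P_k built with Ws by o(1), uniformly in the direction of s_k.
   Since |T[A]^p|_F <= |A|_2^p |T|_F, iterating m times gives
   |F_{k+m}| <= c' |F_k| + o(1) with c' < 1, whence F_k -> 0. *)
Require Import Defs.
From HB Require Import structures.
From mathcomp Require Import all_boot all_order all_algebra all_fingroup.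
From mathcomp Require Import all_classical all_reals all_analysis.
From mathcomp Require Import ring lra.
Import Order.TTheory GRing.Theory Num.Theory.
Import numFieldNormedType.Exports.
Set Implicit Arguments. Unset Strict Implicit. Unset Printing Implicit Defensive.
Local Open Scope ring_scope.
Local Open Scope classical_set_scope.

(** * Euclidean norms of finite families *)
Section L2norm.
Variables (R : realType) (I : finType).
Implicit Types a b : I -> R.

Definition l2 a : R := Num.sqrt (\sum_i a i ^+ 2).

Lemma sqsum_ge0 a : 0 <= \sum_i a i ^+ 2.
Proof. by apply: sumr_ge0 => i _; exact: sqr_ge0. Qed.

Lemma l2_ge0 a : 0 <= l2 a. Proof. exact: sqrtr_ge0. Qed.

Lemma sqr_l2 a : l2 a ^+ 2 = \sum_i a i ^+ 2.
Proof. by rewrite sqr_sqrtr // sqsum_ge0. Qed.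

(** Lagrange's identity: the double sum of the squares of a_i b_j - a_j b_i is twice the difference
    of the two sides. *)
Lemma cauchy_schwarz_sqr a b :
  (\sum_i a i * b i) ^+ 2 <= (\sum_i a i ^+ 2) * (\sum_i b i ^+ 2).
Proof.
have : 0 <= \sum_i \sum_j (a i * b j - a j * b i) ^+ 2.
  by apply: sumr_ge0 => i _; apply: sumr_ge0 => j _; exact: sqr_ge0.
have -> : \sum_i \sum_j (a i * b j - a j * b i) ^+ 2 =
   (\sum_i a i ^+ 2) * (\sum_i b i ^+ 2)
   + (\sum_i b i ^+ 2) * (\sum_i a i ^+ 2)
   - 2 * ((\sum_i a i * b i) * (\sum_i a i * b i)).
  rewrite !big_distrlr mulr_sumr /= -big_split -sumrB; apply: eq_bigr => i _ /=.
  by rewrite mulr_sumr -big_split -sumrB; apply: eq_bigr => j _ /=; ring.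
by rewrite expr2; lra.
Qed.

Lemma cauchy_schwarz a b : `|\sum_i a i * b i| <= l2 a * l2 b.
Proof.
rewrite -sqrtrM ?sqsum_ge0// -sqrtr_sqr ler_wsqrtr //.
exact: cauchy_schwarz_sqr.
Qed.

Lemma l2_triangle a b : l2 (fun i => a i + b i) <= l2 a + l2 b.
Proof.
rewrite -(@ler_pXn2r _ 2) ?nnegrE ?addr_ge0 ?l2_ge0// sqrrD !sqr_l2.
have -> : \sum_i (a i + b i) ^+ 2 =
  \sum_i a i ^+ 2 + (\sum_i a i * b i) *+ 2 + \sum_i b i ^+ 2.
  by rewrite -sumrMnl -!big_split; apply: eq_bigr => i _; rewrite sqrrD.
rewrite lerD2r lerD2l lerMn2r /=.
by apply: le_trans (cauchy_schwarz a b); exact: ler_norm.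
Qed.

Lemma l2Z c a : l2 (fun i => c * a i) = `|c| * l2 a.
Proof.
rewrite /l2 -sqrtr_sqr -sqrtrM ?sqr_ge0// mulr_sumr; congr Num.sqrt.
by apply: eq_bigr => i _; rewrite exprMn.
Qed.

Lemma le_l2 a b : (forall i, `|a i| <= `|b i|) -> l2 a <= l2 b.
Proof.
move=> ab; rewrite ler_wsqrtr//; apply: ler_sum => i _.
by rewrite -(real_normK (num_real (a i))) -(real_normK (num_real (b i)));
   rewrite ler_pXn2r ?nnegrE.
Qed.

Lemma entry_le_l2 a i : `|a i| <= l2 a.
Proof.
rewrite -sqrtr_sqr ler_wsqrtr// (bigD1 i)//= lerDl.
by apply: sumr_ge0 => j _; exact: sqr_ge0.
Qed.

Lemma l2_eq0 a : l2 a = 0 -> forall i, a i = 0.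
Proof.
by move=> a0 i; apply/eqP; rewrite -normr_le0 -a0; exact: entry_le_l2.
Qed.

End L2norm.

(** * Congruences of tensors, one slot at a time *)

Section Tensors.
Variables (R : realType) (n p : nat).
Notation tensor := (tensor R n p).
Notation index := {ffun 'I_p -> 'I_n}.
Implicit Types (T U : tensor) (A B M : 'M[R]_n) (idx : index) (j : 'I_p).

(** Each slot has its own matrix, so that one-slot products and full congruences lie in one family
    closed under composition. *)
Definition tmul T (A : 'I_p -> 'M[R]_n) : tensor :=
  fun idx => \sum_(idx' : index) T idx' * \prod_(j < p) A j (idx' j) (idx j).

Definition upd idx j (i : 'I_n) : index :=
  [ffun l => if l == j then i else idx l].

Definition slot j M T : tensor :=
  fun idx => \sum_i T (upd idx j i) * M i (idx j).

Lemma tcongrE T M : tcongr T M = tmul T (fun=> M).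
Proof.
apply/funext => idx; rewrite /tcongr /teval /tmul; apply: eq_bigr => i _.
by congr (_ * _); apply: eq_bigr => j _; rewrite mxE.
Qed.

Lemma eq_tmul T (A B : 'I_p -> 'M[R]_n) : A =1 B -> tmul T A = tmul T B.
Proof. by move=> /funext ->. Qed.

Lemma tmulM T (A B : 'I_p -> 'M[R]_n) :
  tmul (tmul T A) B = tmul T (fun j => A j *m B j).
Proof.
apply/funext => idx; rewrite /tmul.
under eq_bigr do rewrite mulr_suml.
rewrite exchange_big; apply: eq_bigr => i _ /=.
under eq_bigr do rewrite -mulrA -big_split /=.
rewrite -mulr_sumr; congr (_ * _).
under [RHS]eq_bigr do rewrite mxE.
rewrite bigA_distr_bigA /=; apply: eq_bigr => k _.
by apply: eq_bigr => j _.
Qed.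

Lemma teval_tcongr T M (v : 'I_p -> 'cV[R]_n) :
  teval (tcongr T M) v = teval T (fun j => M *m v j).
Proof.
rewrite tcongrE /teval /tmul.
under eq_bigr do rewrite mulr_suml.
rewrite exchange_big; apply: eq_bigr => i _ /=.
under eq_bigr do rewrite -mulrA -big_split /=.
rewrite -mulr_sumr; congr (_ * _).
under [RHS]eq_bigr do rewrite mxE.
rewrite bigA_distr_bigA /=; apply: eq_bigr => k _.
by apply: eq_bigr => j _.
Qed.

Lemma tcongrM T A B : tcongr (tcongr T A) B = tcongr T (A *m B).
Proof. by rewrite !tcongrE tmulM. Qed.

(* All slots but [j] carry Kronecker deltas, so only the multi-indices that agree
   with [idx] outside [j] survive. *)
Lemma sum_upd T idx j (g : 'I_p -> 'I_n -> R) :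
  (forall l i, l != j -> g l i = (i == idx l)%:R) ->
  \sum_(idx' : index) T idx' * \prod_(l < p) g l (idx' l) =
  \sum_i T (upd idx j i) * g j i.
Proof.
move=> gE; rewrite (partition_big (fun idx' : index => idx' j) predT)//=.
apply: eq_bigr => i _; rewrite (bigD1 (upd idx j i)) /=; last first.
  by rewrite ffunE eqxx.
rewrite [X in _ + X]big1 ?addr0; last first.
  move=> k /andP[/eqP kj kN].
  have /existsP[l /andP[lj kl]] : [exists l, (l != j) && (k l != idx l)].
    apply: contraR kN => /existsPn h.
    apply/eqP/ffunP => l; rewrite ffunE; case: (eqVneq l j) => [->//|lj].
    by have := h l; rewrite lj /= negbK => /eqP.
  by rewrite (bigD1 l)//= gE// (negbTE kl) mul0r mulr0.
congr (_ * _); rewrite (bigD1 j)//= ffunE eqxx big1 ?mulr1// => l lj.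
by rewrite gE// ffunE (negbTE lj) eqxx.
Qed.

Lemma slotE j M T : slot j M T = tmul T (fun l => if l == j then M else 1%:M).
Proof.
apply/funext => idx; rewrite /tmul.
rewrite (@sum_upd T idx j
  (fun l i => (if l == j then M else 1%:M : 'M[R]_n) i (idx l))).
  by rewrite eqxx.
by move=> l i /negbTE ->; rewrite mxE.
Qed.

Lemma tmul1 T : tmul T (fun=> 1%:M) = T.
Proof.
apply/funext => idx; rewrite /tmul (bigD1 idx)//= !big1 ?mulr1 ?addr0//.
  move=> k kN.
  have /existsP[l kl] : [exists l, k l != idx l].
    apply: contraR kN => /existsPn h.
    by apply/eqP/ffunP => l; have := h l; rewrite negbK => /eqP.
  by rewrite (bigD1 l)//= mxE (negbTE kl) mul0r mulr0.
by move=> j _; rewrite mxE eqxx.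
Qed.

Lemma tcongr1 T : tcongr T 1%:M = T.
Proof. by rewrite tcongrE tmul1. Qed.

(* A congruence is the composition of its [p] one-slot products. *)
Lemma tcongr_slot_ind (P : nat -> tensor -> Prop) T M :
  P 0%N T -> (forall k j U, P k U -> P k.+1 (slot j M U)) -> P p (tcongr T M).
Proof.
move=> P0 PS.
(* After k steps the slots below k carry [M] and the others the identity. *)
suff h k : (k <= p)%N ->
    P k (tmul T (fun l : 'I_p => if (l < k)%N then M else 1%:M)).
  rewrite tcongrE (_ : tmul _ _ = tmul T (fun l : 'I_p => if (l < p)%N then M else 1%:M)).
    exact: h.
  by apply: eq_tmul => l; rewrite ltn_ord.
elim: k => [_|k ih kp]; first by rewrite tmul1.
have := PS k (Ordinal kp) _ (ih (ltnW kp)).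
rewrite slotE tmulM
  (_ : tmul _ _ = tmul T (fun l : 'I_p => if (l < k.+1)%N then M else 1%:M)) //.
apply: eq_tmul => l; rewrite ltnS (leq_eqVlt l k) -val_eqE /=.
case: (eqVneq (l : nat) k) => [->|] /=; first by rewrite ltnn mul1mx.
by rewrite mulmx1.
Qed.

Definition tperm_act (s : 'S_p) idx : index := [ffun j => idx (s j)].

(** The sum over multi-indices and the product over slots are both reindexed along the
    permutation. *)
Lemma tsym_tcongr T M : tsym T -> tsym (tcongr T M).
Proof.
move=> Ts s idx; rewrite tcongrE /tmul.
have bij : bijective (tperm_act s).
  exists (tperm_act s^-1) => k; apply/ffunP => l; rewrite !ffunE; congr (k _).
    exact: permKV.
  exact: permK.
rewrite (reindex (tperm_act s)) /=; last by apply: onW_bij.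
apply: eq_bigr => k _; congr (_ * _); first exact: Ts.
rewrite [RHS](reindex s) /=; last first.
  by apply: onW_bij; exists (s^-1)%g; [exact: permK|exact: permKV].
by apply: eq_bigr => l _; rewrite !ffunE.
Qed.

Lemma tsym_tsub T U : tsym T -> tsym U -> tsym (tsub T U).
Proof. by move=> Ts Us s idx; rewrite /tsub Ts Us. Qed.

Lemma tcongr_sub T U M :
  tcongr (tsub T U) M = tsub (tcongr T M) (tcongr U M).
Proof.
apply/funext => idx; rewrite /tsub !tcongrE /tmul -sumrB.
by apply: eq_bigr => k _; rewrite mulrBl.
Qed.

Lemma teval_tsub T U v : teval (tsub T U) v = teval T v - teval U v.
Proof. by rewrite /teval -sumrB; apply: eq_bigr => k _; rewrite mulrBl. Qed.

Lemma tsub0P T U : (forall idx, tsub T U idx = 0) -> T = U.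
Proof. by move=> h; apply/funext => idx; apply/eqP; rewrite -subr_eq0; apply/eqP/h. Qed.

(** By symmetry a transposition moves slot [j] to slot [j0]; basis vectors as the remaining
    arguments then isolate one entry of the contraction. *)
Lemma contraction_slot0 (j0 : 'I_p) T (s : 'cV[R]_n) : val j0 = 0%N -> tsym T ->
  (forall v, teval T (fix_first s v) = 0) ->
  forall j idx, \sum_i T (upd idx j i) * s i 0 = 0.
Proof.
move=> j00 Ts Tv j idx.
pose idx' := tperm_act (tperm j0 j) idx.
have E i : T (upd idx j i) = T (upd idx' j0 i).
  rewrite -(Ts (tperm j0 j)); congr T; apply/ffunP => l; rewrite !ffunE.
  by rewrite -[X in _ == X](tpermL j0 j) (inj_eq perm_inj).
under eq_bigr do rewrite E.
have := Tv (fun l => evec R (idx' l)); rewrite /teval.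
rewrite (@sum_upd T idx' j0 (fun l i => (fix_first s (fun l0 => evec R (idx' l0)) l i 0))).
  by rewrite /fix_first j00 eqxx.
move=> l i; rewrite -val_eqE j00 /fix_first => /negbTE ->.
by rewrite /evec mxE eqxx andbT.
Qed.

(** In each slot the rank-one term contributes a multiple of the contraction of [T] with [s], which
    is zero, so every one-slot product returns [T]. *)
Lemma tcongr_fix (j0 : 'I_p) T (s w : 'cV[R]_n) : val j0 = 0%N -> tsym T ->
  (forall v, teval T (fix_first s v) = 0) ->
  tcongr T (1%:M - s *m w^T) = T.
Proof.
move=> j00 Ts Tv; have c0 := contraction_slot0 j00 Ts Tv.
apply: (@tcongr_slot_ind (fun _ U => U = T)) => // _ j _ ->.
apply/funext => idx; rewrite /slot.
under eq_bigr do rewrite !mxE big_ord1 !mxE mulrBr mulrA.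
rewrite sumrB -mulr_suml c0 mul0r subr0 (bigD1 (idx j))//= eqxx mulr1.
rewrite big1 ?addr0.
  congr T; apply/ffunP => l; rewrite ffunE; case: eqP => // ->//.
by move=> i /negbTE ->; rewrite mulr0.
Qed.

End Tensors.

(** * Spectral and Frobenius norm estimates *)

Section OperatorBounds.
Variables (R : realType) (n : nat).
Implicit Types (A B : 'M[R]_n) (u v y z : 'cV[R]_n) (s t e : R).

(** A bound on the spectral norm that avoids the supremum; [opb_spec_norm] makes the link. *)
Definition opb A s := forall v, euclid (A *m v) <= s * euclid v.

Lemma euclid_ge0 v : 0 <= euclid v. Proof. exact: l2_ge0. Qed.

Lemma euclidD u v : euclid (u + v) <= euclid u + euclid v.
Proof.
apply: le_trans (l2_triangle _ _); apply: le_l2 => i.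
by rewrite mxE.
Qed.

Lemma euclidZ s v : euclid (s *: v) = `|s| * euclid v.
Proof.
rewrite /euclid -/(l2 (fun i => v i 0)) -l2Z /l2; congr Num.sqrt.
by apply: eq_bigr => i _; rewrite mxE.
Qed.

Lemma euclidN v : euclid (- v) = euclid v.
Proof. by rewrite -scaleN1r euclidZ normrN1 mul1r. Qed.

Lemma euclid_eq0 v : (euclid v == 0) = (v == 0).
Proof.
apply/eqP/eqP => [v0|->].
  by apply/matrixP => i j; rewrite ord1 mxE; exact: (l2_eq0 v0).
by rewrite -(scale0r 0) euclidZ normr0 mul0r.
Qed.

Definition dot u v : R := (u^T *m v) 0 0.

Lemma dotE u v : dot u v = \sum_i u i 0 * v i 0.
Proof. by rewrite /dot mxE; apply: eq_bigr => i _; rewrite mxE. Qed.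

Lemma dotC u v : dot u v = dot v u.
Proof. by rewrite !dotE; apply: eq_bigr => i _; rewrite mulrC. Qed.

Lemma dotDr u v y : dot u (v + y) = dot u v + dot u y.
Proof. by rewrite /dot mulmxDr mxE. Qed.

Lemma dotvv v : dot v v = euclid v ^+ 2.
Proof. by rewrite dotE (sqr_l2 (fun i => v i 0)). Qed.

Lemma le_dot u v : `|dot u v| <= euclid u * euclid v.
Proof. by rewrite dotE; exact: (cauchy_schwarz (fun i => u i 0)). Qed.

Lemma dot_mulmx A u v : dot u (A *m v) = dot (A^T *m u) v.
Proof. by rewrite /dot trmx_mul trmxK mulmxA. Qed.

Lemma opb_mul A B s t : 0 <= s -> opb A s -> opb B t -> opb (A *m B) (s * t).
Proof.
move=> s0 As Bt v; rewrite -mulmxA -mulrA.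
by apply: le_trans (As _) _; rewrite ler_wpM2l.
Qed.

Lemma opb_add A B s t : opb A s -> opb B t -> opb (A + B) (s + t).
Proof.
move=> As Bt v; rewrite mulmxDl mulrDl.
by apply: le_trans (euclidD _ _) _; rewrite lerD.
Qed.

Lemma opb_opp A s : opb A s -> opb (- A) s.
Proof. by move=> As v; rewrite mulNmx euclidN. Qed.

Lemma opb_le A s t : s <= t -> opb A s -> opb A t.
Proof.
by move=> st As v; apply: le_trans (As v) _; rewrite ler_wpM2r ?euclid_ge0.
Qed.

Lemma opb1 : opb 1%:M 1.
Proof. by move=> v; rewrite mul1mx mul1r. Qed.

(** With w = A^T v, |w|^2 = <A w, v> <= s |w| |v|; then divide by |w|. *)
Lemma opb_tr A s : 0 <= s -> opb A s -> opb A^T s.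
Proof.
move=> s0 As v; set w := A^T *m v.
have [->|w0] := eqVneq (euclid w) 0; first by rewrite mulr_ge0 ?euclid_ge0.
have wgt : 0 < euclid w by rewrite lt_def w0 euclid_ge0.
rewrite -(ler_pM2r wgt) -expr2 -dotvv {2}/w dot_mulmx trmxK.
apply: le_trans (ler_norm _) _; apply: le_trans (le_dot _ _) _.
by rewrite [leRHS]mulrAC ler_wpM2r ?euclid_ge0.
Qed.

Lemma opb_entries A e : 0 <= e -> (forall i j, `|A i j| <= e) ->
  opb A (n%:R * e).
Proof.
move=> e0 Ae v; have ne0 : 0 <= n%:R * e by rewrite mulr_ge0.
rewrite -(@ler_pXn2r _ 2) ?nnegrE ?mulr_ge0 ?euclid_ge0//.
rewrite (sqr_l2 (fun i => (A *m v) i 0)) exprMn.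
have row_le i : (A *m v) i 0 ^+ 2 <= (n%:R * e ^+ 2) * euclid v ^+ 2.
  rewrite mxE; apply: le_trans (cauchy_schwarz_sqr _ _) _.
  rewrite -(sqr_l2 (fun i => v i 0)) ler_wpM2r ?sqr_ge0//.
  apply: (@le_trans _ _ (\sum_(j < n) e ^+ 2)).
    apply: ler_sum => j _.
    by rewrite -(real_normK (num_real (A i j))) ler_pXn2r ?nnegrE.
  by rewrite sumr_const card_ord -[_ *+ n]mulr_natl.
apply: (@le_trans _ _ (\sum_(i < n) n%:R * e ^+ 2 * euclid v ^+ 2)).
  by apply: ler_sum => i _; exact: row_le.
by rewrite sumr_const card_ord -[_ *+ n]mulr_natl !mulrA exprMn expr2 !mulrA.
Qed.

Lemma opb_rank1 y z : euclid y = 1 -> opb (y *m z^T) (euclid z).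
Proof.
move=> y1 v; have -> : y *m z^T *m v = dot z v *: y.
  rewrite -mulmxA; apply/matrixP => i j; rewrite ord1 mxE big_ord1 mulrC.
  by rewrite [RHS]mxE.
by rewrite euclidZ y1 mulr1; exact: le_dot.
Qed.

Lemma opb_ex A : exists2 s, 0 <= s & opb A s.
Proof.
pose e := \sum_i \sum_j `|A i j|.
have e0 : 0 <= e by apply: sumr_ge0 => i _; apply: sumr_ge0.
exists (n%:R * e); first by rewrite mulr_ge0.
apply: opb_entries => // i j; rewrite /e (bigD1 i)//= (bigD1 j)//= -addrA lerDl.
by rewrite addr_ge0 ?sumr_ge0// => k _; apply: sumr_ge0.
Qed.

(** [opb_ex] supplies the upper bound that gives [sup] its meaning; a nonzero vector is then
    normalized. *)
Lemma opb_spec_norm A : opb A (spec_norm A).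
Proof.
move=> v; have [s s0 As] := opb_ex A.
have [v0|vN0] := eqVneq v 0.
  have z0 : euclid (0 : 'cV[R]_n) = 0 by apply/eqP; rewrite euclid_eq0.
  by rewrite v0 mulmx0 z0 mulr0.
have vgt : 0 < euclid v by rewrite lt_def euclid_eq0 vN0 euclid_ge0.
rewrite -ler_pdivrMr// mulrC -[_^-1]ger0_norm ?invr_ge0 ?euclid_ge0//.
rewrite -euclidZ scalemxAr; apply: ub_le_sup; last first.
  exists ((euclid v)^-1 *: v) => //=.
  by rewrite euclidZ ger0_norm ?invr_ge0 ?euclid_ge0// mulVf ?gt_eqF.
exists s => _ [u /= u1 <-]; apply: le_trans (As u) _.
by rewrite -[leRHS]mulr1 ler_wpM2l.
Qed.

End OperatorBounds.

(** * Congruences and the Frobenius norm *)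

Section FrobeniusBounds.
Variables (R : realType) (n p : nat).
Notation tensor := (tensor R n p).
Notation index := {ffun 'I_p -> 'I_n}.
Implicit Types (T U : tensor) (A M : 'M[R]_n) (idx : index) (j : 'I_p).

Lemma frob_ge0 T : 0 <= frob T. Proof. exact: l2_ge0. Qed.

Lemma entry_le_frob T idx : `|T idx| <= frob T.
Proof. exact: (@entry_le_l2 _ index). Qed.

Definition tadd T U : tensor := fun idx => T idx + U idx.

Lemma frobD T U : frob (tadd T U) <= frob T + frob U.
Proof. exact: (@l2_triangle _ index). Qed.

Lemma frobB T U : frob (tsub T U) <= frob T + frob U.
Proof.
have <- : frob (fun idx => -1 * U idx) = frob U.
  by apply: etrans (@l2Z _ index (-1) U) _; rewrite normrN1 mul1r.
apply: le_trans (frobD _ _); apply: (@le_l2 _ index) => k.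
by rewrite /tsub /tadd mulN1r.
Qed.

Lemma upd_upd idx j i l : upd (upd idx j l) j i = upd idx j i.
Proof. by apply/ffunP => k; rewrite !ffunE; case: eqP. Qed.

Lemma upd_same idx j : upd idx j (idx j) = idx.
Proof. by apply/ffunP => k; rewrite !ffunE; case: eqP => // ->. Qed.

(* Each multi-index arises [n] times as [upd idx j i]: the map
   [(idx, i) |-> (upd idx j i, idx j)] is an involution. *)
Lemma sum_upd_all j (g : index -> R) :
  \sum_idx \sum_i g (upd idx j i) = n%:R * \sum_idx g idx.
Proof.
pose h (a : index * 'I_n) := (upd a.1 j a.2, a.1 j).
have hK : involutive h.
  by case=> k i; rewrite /h /= upd_upd upd_same ffunE eqxx.
rewrite pair_big /= (reindex h) /=; last by apply/onW_bij/inv_bij.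
transitivity (\sum_(a : index * 'I_n) g a.1).
  by apply: eq_bigr => -[k i] _ /=; rewrite upd_upd upd_same.
rewrite -(pair_big predT predT (fun k _ => g k)) /= mulr_sumr.
by apply: eq_bigr => k _; rewrite sumr_const card_ord mulr_natl.
Qed.

(** With all indices outside slot [j] fixed, the entries of [T] form a vector on which the product
    acts as [A^T]. [sum_upd_all] sums over these fibres and brings in a factor [n] on both sides;
    cancelling it is why [n = 0], where there is no multi-index, is treated apart. *)
Lemma frob_slot j T A s : 0 <= s -> opb A s -> frob (slot j A T) <= s * frob T.
Proof.
move=> s0 As; have [n0|n0] := posnP n.
  suff -> : frob (slot j A T) = 0 by rewrite mulr_ge0 ?frob_ge0.
  rewrite /frob big1 ?sqrtr0// => k _.
  have n_gt0 : (0 < n)%N by case: (k j) => ? /(leq_ltn_trans (leq0n _)).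
  by rewrite n0 in n_gt0.
rewrite -(@ler_pXn2r _ 2) ?nnegrE ?mulr_ge0 ?frob_ge0// exprMn.
rewrite !(@sqr_l2 _ index) -(@ler_pM2l _ n%:R) ?ltr0n// mulrCA.
rewrite -(sum_upd_all j (fun idx => T idx ^+ 2)).
rewrite -(sum_upd_all j (fun idx => slot j A T idx ^+ 2)) mulr_sumr.
apply: ler_sum => k _.
pose t : 'cV[R]_n := \col_i T (upd k j i).
have -> : \sum_i T (upd k j i) ^+ 2 = euclid t ^+ 2.
  by rewrite (sqr_l2 (fun i => t i 0)); apply: eq_bigr => i _; rewrite mxE.
have -> : \sum_i slot j A T (upd k j i) ^+ 2 = euclid (A^T *m t) ^+ 2.
  rewrite (sqr_l2 (fun i => (A^T *m t) i 0)); apply: eq_bigr => i _.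
  congr (_ ^+ 2); rewrite /slot mxE; apply: eq_bigr => l _.
  by rewrite upd_upd ffunE eqxx !mxE mulrC.
rewrite -exprMn ler_pXn2r ?nnegrE ?mulr_ge0 ?euclid_ge0//.
exact: (opb_tr s0 As).
Qed.

Lemma frob_tcongr T A s : 0 <= s -> opb A s ->
  frob (tcongr T A) <= s ^+ p * frob T.
Proof.
move=> s0 As.
apply: (@tcongr_slot_ind _ _ _ (fun k U => frob U <= s ^+ k * frob T)).
  by rewrite mul1r.
move=> k j U Uk; apply: le_trans (frob_slot j U s0 As) _.
by rewrite exprS -mulrA ler_wpM2l.
Qed.

Definition tdot T U : R := \sum_idx T idx * U idx.

Lemma tdot_tcongr T U A : tdot (tcongr T A) U = tdot T (tcongr U A^T).
Proof.
rewrite /tdot !tcongrE /tmul; under eq_bigr do rewrite mulr_suml.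
rewrite exchange_big /=; apply: eq_bigr => k _; rewrite mulr_sumr.
apply: eq_bigr => l _; rewrite -mulrA; congr (_ * _); rewrite mulrC.
by congr (_ * _); apply: eq_bigr => j _; rewrite mxE.
Qed.

(* For a symmetric idempotent [Q] the congruence by [Q] is an orthogonal projection. *)
Lemma tcongr_proj_eq0 T (Q : 'M[R]_n) : Q^T = Q -> Q *m Q = Q ->
  frob T <= frob (tsub T (tcongr T Q)) -> forall idx, tcongr T Q idx = 0.
Proof.
move=> Qs QQ; set Y := tcongr T Q.
have TY : tdot T Y = tdot Y Y.
  by rewrite {2}/Y tdot_tcongr Qs /Y tcongrM QQ.
rewrite -(@ler_pXn2r _ 2) ?nnegrE ?frob_ge0// !(@sqr_l2 _ index) => h k.
suff Y0 : frob Y = 0 by exact: (l2_eq0 Y0).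
apply/eqP; rewrite -sqrf_eq0 (@sqr_l2 _ index) eq_le sqsum_ge0 andbT.
(* Pythagoras: |T - Y|^2 = |T|^2 - |Y|^2, because <T, Y> = <Y, Y>; the hypothesis then forces |Y|^2
   <= 0. *)
suff E : \sum_i (tsub T Y) i ^+ 2 = \sum_i T i ^+ 2 - \sum_i Y i ^+ 2.
  by move: h; rewrite E lerBDr -subr_ge0 opprD addrA subrr add0r oppr_ge0.
have -> : \sum_i Y i ^+ 2 = \sum_i (2 * (T i * Y i) - Y i ^+ 2).
  rewrite sumrB -mulr_sumr -/(tdot T Y) TY /tdot.
  under [X in 2 * X]eq_bigr do rewrite -expr2.
  by rewrite mulr_natl mulr2n addrK.
by rewrite -sumrB; apply: eq_bigr => i _; rewrite /tsub; ring.
Qed.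

End FrobeniusBounds.

(** * Symmetry and continuity of iterated derivatives *)

Section Clairaut.
Variables (R : realType) (V : normedModType R).
Implicit Types (g : V -> R) (u v y : V) (h t : R).

(** Both difference quotients are the same function of [h], which opens the one-variable mean value
    theorem to [g] along a line. *)
Lemma is_derive_line g y v t : derivable g (y + t *: v) v ->
  is_derive t (1 : R) (fun t => g (y + t *: v)) ('D_v g (y + t *: v)).
Proof.
have E : (fun h : R => h^-1 *: (((fun t => g (y + t *: v)) \o shift t) (h *: (1 : R))
            - g (y + t *: v)))
       = (fun h => h^-1 *: ((g \o shift (y + t *: v)) (h *: v) - g (y + t *: v))).
  apply/funext => h /=; congr (_ *: (g _ - _)).
  by rewrite [h *: (1 : R)]mulr1 scalerDl addrCA.
by move=> dg; split; rewrite /derivable /derive E.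
Qed.

Lemma MVT_line g y v h : 0 < h -> (forall z, derivable g z v) ->
  exists2 a, 0 <= a <= h & g (y + h *: v) - g y = h * 'D_v g (y + a *: v).
Proof.
move=> h0 dg.
have dl t : is_derive t (1 : R) (fun t => g (y + t *: v)) ('D_v g (y + t *: v)).
  exact: is_derive_line.
have [|a] := @MVT R (fun t => g (y + t *: v)) (fun t => 'D_v g (y + t *: v)) 0 h h0.
  apply: continuous_subspaceT => t.
  by apply: differentiable_continuous; apply/derivable1_diffP; have [] := dl t.
rewrite in_itv /= => /andP[a0 ah]; rewrite scale0r addr0 subr0 => ->.
by exists a; [rewrite !ltW|rewrite mulrC].
Qed.

(** The mean value theorem is applied in direction [u] to z |-> g (z + h v) - g z, then in direction
    [v] to ['D_u g]. *)
Lemma second_difference g u v y h : 0 < h ->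
  (forall z, derivable g z u) -> (forall z, derivable ('D_u g) z v) ->
  exists a b, [/\ 0 <= a <= h, 0 <= b <= h &
    g (y + h *: u + h *: v) - g (y + h *: u) - g (y + h *: v) + g y
      = h * (h * 'D_v ('D_u g) (y + a *: u + b *: v))].
Proof.
move=> h0 du dvu.
pose g' z := g (z + h *: v) - g z.
have dshift z : is_derive z u (fun z => g (z + h *: v)) ('D_u g (z + h *: v)).
  have E : (fun k : R => k^-1 *: (((fun z => g (z + h *: v)) \o shift z) (k *: u)
            - g (z + h *: v)))
       = (fun k => k^-1 *: ((g \o shift (z + h *: v)) (k *: u) - g (z + h *: v))).
    by apply/funext => k /=; rewrite -addrA.
  by have := du (z + h *: v); split; rewrite /derivable /derive E.
have dg' z : is_derive z u g' ('D_u g (z + h *: v) - 'D_u g z).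
  have dz := @derivableP _ _ _ _ _ _ (du z).
  exact: (@is_deriveB _ _ _ (fun z => g (z + h *: v)) g).
have [|a ah Ea] := @MVT_line g' y u h h0; first by move=> z; have [] := dg' z.
have [b bh Eb] := @MVT_line ('D_u g) (y + a *: u) v h h0 dvu.
exists a, b; split=> //; rewrite -Eb -(@derive_val _ _ _ _ _ _ _ (dg' (y + a *: u))) -Ea /g'.
by ring.
Qed.

Lemma eq_at_limit (A B : V -> R) u v y :
  {for y, continuous A} -> {for y, continuous B} ->
  (forall h, 0 < h -> exists a b a' b',
    [/\ 0 <= a <= h, 0 <= b <= h, 0 <= a' <= h, 0 <= b' <= h &
      A (y + a *: u + b *: v) = B (y + a' *: v + b' *: u)]) ->
  A y = B y.
Proof.
move=> cA cB AB; apply/eqP; rewrite -subr_eq0 -normr_le0.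
apply/ler_addgt0Pr => e e0; rewrite add0r.
have e20 : 0 < e / 2 by rewrite divr_gt0.
have /cvgrPdist_le/(_ _ e20)/nbhs_ballP[d1 /= d10 H1] := cA.
have /cvgrPdist_le/(_ _ e20)/nbhs_ballP[d2 /= d20 H2] := cB.
pose d := Num.min d1 d2; have d0 : 0 < d by rewrite lt_min d10.
pose s := `|u| + `|v| + 1; have s0 : 0 < s by rewrite ltr_wpDl ?addr_ge0.
(* With this choice h s = d / 2, so all intermediate points stay within [d] of [y]; the 1 in [s]
   keeps it positive. *)
pose h := d / (2 * s); have h0 : 0 < h by rewrite divr_gt0 ?mulr_gt0.
have near a b (w w' : V) : `|w| + `|w'| <= s -> 0 <= a <= h -> 0 <= b <= h ->
    `|y - (y + a *: w + b *: w')| < d.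
  move=> ws /andP[a0 ah] /andP[b0 bh].
  rewrite -addrA opprD addNKr normrN.
  apply: (@le_lt_trans _ _ (h * s)).
    apply: le_trans (ler_normD _ _) _; rewrite !normrZ !ger0_norm//.
    apply: le_trans (ler_wpM2l (ltW h0) ws); rewrite mulrDr.
    by apply: lerD; exact: ler_wpM2r.
  by rewrite /h invfM mulrA -mulrA mulVf ?gt_eqF// mulr1 ltr_pdivrMr// ltr_pMr// ltr1n.
have uvs : `|u| + `|v| <= s by rewrite lerDl.
have vus : `|v| + `|u| <= s by rewrite addrC.
have [a [b [a' [b' [ah bh ah' bh' E]]]]] := AB h h0.
have /H1 A1 : ball y d1 (y + a *: u + b *: v).
  by rewrite -ball_normE /=; apply: lt_le_trans (near _ _ _ _ uvs ah bh) _;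
    rewrite ge_min lexx.
have /H2 A2 : ball y d2 (y + a' *: v + b' *: u).
  by rewrite -ball_normE /=; apply: lt_le_trans (near _ _ _ _ vus ah' bh') _;
    rewrite ge_min lexx orbT.
rewrite distrC in A2.
apply: le_trans (ler_distD (A (y + a *: u + b *: v)) _ _) _.
by rewrite [e]splitr lerD// E.
Qed.

(** Schwarz's theorem: the second difference is symmetric in [u] and [v], so both mixed derivatives,
    each at its own point near [y], equal it divided by h^2; continuity does the rest. *)
Lemma derive_comm g u v y :
  (forall z, derivable g z u) -> (forall z, derivable g z v) ->
  (forall z, derivable ('D_u g) z v) -> (forall z, derivable ('D_v g) z u) ->
  {for y, continuous ('D_v ('D_u g))} -> {for y, continuous ('D_u ('D_v g))} ->
  'D_v ('D_u g) y = 'D_u ('D_v g) y.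
Proof.
move=> du dv dvu duv cA cB; apply: (eq_at_limit cA cB) => h h0.
have [a [b [ah bh E1]]] := @second_difference g u v y h h0 du dvu.
have [a' [b' [ah' bh' E2]]] := @second_difference g v u y h h0 dv duv.
exists a, b, a', b'; split; [exact: ah|exact: bh|exact: ah'|exact: bh'|].
apply: (mulfI (lt0r_neq0 h0)); apply: (mulfI (lt0r_neq0 h0)).
apply: etrans (esym E1) _; apply: etrans E2.
by rewrite [y + h *: v + h *: u]addrAC; congr (_ + _); exact: addrAC.
Qed.

End Clairaut.

Section SymmetricDerivative.
Variables (R : realType) (n p : nat) (f : 'cV[R]_n -> R).
Hypothesis fCp : Cp p f.

Lemma iterD_swap i j l : ((size l).+2 <= p)%N ->
  Defs.iterD f (i :: j :: l) = Defs.iterD f (j :: i :: l).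
Proof.
move: fCp => [fd fc] lp; apply/funext => x /=.
have lp1 : (size l < p)%N := ltnW lp.
apply: derive_comm => z.
- exact: fd.
- exact: fd.
- exact: (fd (j :: l)).
- exact: (fd (i :: l)).
- exact: (fc (i :: j :: l)).
- exact: (fc (j :: i :: l)).
Qed.

Lemma iterD_cons i l l' : Defs.iterD f l = Defs.iterD f l' ->
  Defs.iterD f (i :: l) = Defs.iterD f (i :: l').
Proof. by move=> E; apply/funext => x; rewrite /Defs.iterD -!/(Defs.iterD _ _) E. Qed.

Lemma iterD_move i l1 l2 : (size (l1 ++ i :: l2) <= p)%N ->
  Defs.iterD f (l1 ++ i :: l2) = Defs.iterD f (i :: l1 ++ l2).
Proof.
elim: l1 => [//|j l1 ih] lp; rewrite !cat_cons.
apply: etrans (iterD_cons j (ih (ltnW lp))) _; apply: iterD_swap.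
by move: lp; rewrite cat_cons /= !size_cat /= addnS.
Qed.

(** Induction on [l]: [iterD_move] brings its head to the front of [l'] by adjacent swaps. *)
Lemma iterD_perm l l' : perm_eq l l' -> (size l <= p)%N ->
  Defs.iterD f l = Defs.iterD f l'.
Proof.
elim: l l' => [|i l ih] l' ll'; first by move/perm_size/esym/size0nil: ll' => ->.
have : i \in l' by rewrite -(perm_mem ll') mem_head.
move=> il'; move: ll'; case/splitPr: il' => l1 l2 ll' lp.
apply: etrans (esym (iterD_move _)); last by rewrite -(perm_size ll').
apply/iterD_cons/ih; last exact: ltnW.
by move: ll'; rewrite perm_sym perm_catC /= perm_cons perm_catC perm_sym.
Qed.

Lemma Dp_sym x : tsym (Dp f x : tensor R n p).
Proof.
move=> s idx; rewrite /Dp; congr (_ x); apply: iterD_perm; last first.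
  by rewrite size_map size_enum_ord.
under eq_map do rewrite ffunE; rewrite (map_comp idx s); apply: perm_map.
apply: uniq_perm; rewrite ?(map_inj_uniq perm_inj) ?enum_uniq// => j.
by rewrite mem_enum inE -[j](permKV s) map_f ?mem_enum.
Qed.

Lemma Dp_avg_sym x s : tsym (Dp_avg f x s : tensor R n p).
Proof.
move=> sg idx; rewrite /Dp_avg; congr Rintegral.
by apply/funext => t; rewrite Dp_sym.
Qed.

Lemma Dp_continuous idx : continuous (fun x => (Dp f x : tensor R n p) idx).
Proof. by move: fCp => [_ fc]; apply: fc; rewrite size_map size_enum_ord. Qed.

End SymmetricDerivative.

(** * Limit of averages over shrinking segments *)

Section Average.
Variables (R : realType) (V : normedModType R).

(** The segments shrink to [xs] uniformly in [t], so for large [k] the integrand is within [e] of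
    [g xs] on all of [0, 1], whose length is 1. *)
Lemma Rintegral_segment_cvg (g : V -> R) (x : nat -> V) (xs : V) :
  continuous g -> x @ \oo --> xs ->
  (fun k => Rintegral (@lebesgue_measure R) `[0, 1]%classic
     (fun t => g (x k + t *: (x k.+1 - x k)))) @ \oo --> g xs.
Proof.
move=> cg xxs; apply/cvgrPdist_le => e e0.
have /cvgrPdist_le/(_ _ e0)/nbhs_ballP[d /= d0 H] := cg xs.
have /cvgrPdist_lt/(_ _ d0)[N _ HN] := xxs.
exists N => //= k Nk.
set I := `[0, 1]%classic : set R.
have mI : measurable I by exact: measurable_itv.
have int1 (q : R -> R) : continuous q ->
    (@lebesgue_measure R).-integrable I (EFin \o q).
  move=> cq; apply: continuous_compact_integrable; first exact: segment_compact.
  exact: continuous_subspaceT.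
set G := fun t : R => g (x k + t *: (x k.+1 - x k)).
have cG : continuous G.
  move=> t; apply: continuous_comp; last exact: cg.
  apply: cvgD; [exact: cvg_cst|apply: cvgZ; [exact: cvg_id|exact: cvg_cst]].
have icst r : Rintegral (@lebesgue_measure R) I (fun=> r) = r.
  by rewrite Rintegral_cst//= lebesgue_measure_itv /= lte_fin ltr01 oppr0 adde0 mulr1.
rewrite -[g xs]icst -RintegralB//; last 2 first.
- by apply: int1 => t; exact: cvg_cst.
- exact: int1.
have cD : continuous (fun t => g xs - G t).
  by move=> t; apply: cvgB; [exact: cvg_cst|exact: cG].
apply: le_trans; first by apply: le_normr_Rintegral => //; exact: int1.
rewrite -[leRHS]icst; apply: le_Rintegral => //.
- by apply: (int1 (fun t => `|g xs - G t|)) => t; apply: cvg_norm; exact: cD.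
- by apply: int1 => t; exact: cvg_cst.
move=> t; rewrite /I /= in_itv /= => /andP[t0 t1]; apply: H.
rewrite -ball_normE /=.
have -> : xs - (x k + t *: (x k.+1 - x k)) = (1 - t) *: (xs - x k) + t *: (xs - x k.+1).
  by rewrite scalerBl scale1r !scalerBr opprD !opprB !addrA subrK.
apply: le_lt_trans (ler_normD _ _) _; rewrite !normrZ !ger0_norm ?subr_ge0//.
have d1 : `|xs - x k| < d by apply: HN.
have d2 : `|xs - x k.+1| < d by apply: HN; rewrite /= leqW.
(* At t = 0 the strict inequality must come from the first term; otherwise it comes from the
   second. *)
move: t0; rewrite le_eqVlt => /orP[/eqP <-|t0]; first by rewrite subr0 mul0r mul1r addr0.
rewrite [ltRHS](_ : d = (1 - t) * d + t * d); last by ring.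
by apply: ler_ltD; [rewrite ler_wpM2l ?subr_ge0// ltW|rewrite ltr_pM2l].
Qed.

End Average.

(** * The secant projections *)

Section Projections.
Variables (R : realType) (n : nat).
Implicit Types (A B Q W V : 'M[R]_n) (a s u v y z : 'cV[R]_n).

(** |Q v|^2 = <Q v, v> <= |Q v| |v|, by symmetry and idempotence. *)
Lemma opb_proj Q : Q^T = Q -> Q *m Q = Q -> opb Q 1.
Proof.
move=> Qs QQ v; rewrite mul1r; set w := Q *m v.
have [->|w0] := eqVneq (euclid w) 0; first exact: euclid_ge0.
have wgt : 0 < euclid w by rewrite lt_def w0 euclid_ge0.
rewrite -(ler_pM2r wgt) -expr2 -dotvv {2}/w dot_mulmx Qs.
rewrite {1}/w mulmxA QQ -/w dotC.
by apply: le_trans (ler_norm _) _; exact: le_dot.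
Qed.

Lemma trmxZ (c : R) v : (c *: v)^T = c *: v^T.
Proof. by apply/matrixP => i j; rewrite !mxE. Qed.

Lemma trmxB u v : (u - v)^T = u^T - v^T.
Proof. by apply/matrixP => i j; rewrite !mxE. Qed.

(** For nonzero [a], the orthogonal projection onto the hyperplane orthogonal to [a]. *)
Definition line_proj a : 'M[R]_n := 1%:M - (dot a a)^-1 *: (a *m a^T).

Lemma outer_mulmx a z v : a *m z^T *m v = dot z v *: a.
Proof. by rewrite -mulmxA; apply/matrixP => i j; rewrite ord1 !mxE big_ord1 mulrC. Qed.

Lemma line_proj_tr a : (line_proj a)^T = line_proj a.
Proof. by rewrite /line_proj linearB /= linearZ /= trmx_mul trmxK tr_scalar_mx. Qed.

Lemma dot_gt0 a : a != 0 -> 0 < dot a a.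
Proof. by move=> a0; rewrite dotvv exprn_gt0// lt_def euclid_eq0 a0 euclid_ge0. Qed.

Lemma line_proj0 a : a != 0 -> line_proj a *m a = 0.
Proof.
move=> a0; rewrite mulmxBl mul1mx -scalemxAl outer_mulmx scalerA.
by rewrite mulVf ?scale1r ?subrr// gt_eqF// dot_gt0.
Qed.

Lemma line_proj_idem a : a != 0 -> line_proj a *m line_proj a = line_proj a.
Proof.
move=> a0; rewrite {2}/line_proj mulmxBr mulmx1 -scalemxAr mulmxA line_proj0//.
by rewrite mul0mx scaler0 subr0.
Qed.

Lemma opb_line_proj a : a != 0 -> opb (line_proj a) 1.
Proof. by move=> a0; apply: opb_proj; [exact: line_proj_tr|exact: line_proj_idem]. Qed.

Lemma proj_factorE W s : proj_factor W s = line_proj (invmx W *m s).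
Proof.
rewrite /proj_factor /line_proj /dot trmx_mul; congr (_ - _ *: _).
  by congr (_ ^-1); rewrite !mulmxA.
by rewrite !mulmxA.
Qed.

(** The covector w for which I - s w^T is the conjugate by [W] of the projection along W^-1 s; this
    rank-one form is the one [tcongr_fix] accepts. *)
Definition secant_covector W s : 'cV[R]_n :=
  (dot (invmx W *m s) (invmx W *m s))^-1 *: ((invmx W)^T *m (invmx W *m s)).
Definition secant_factor W s : 'M[R]_n := 1%:M - s *m (secant_covector W s)^T.

Lemma secant_factorE W s : W \in unitmx ->
  secant_factor W s = W *m line_proj (invmx W *m s) *m invmx W.
Proof.
move=> Wu; rewrite /secant_factor /secant_covector /line_proj trmxZ.
rewrite trmx_mul trmxK mulmxBr mulmxBl mulmx1 mulmxV//; congr (_ - _).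
by rewrite -!scalemxAr -scalemxAl !mulmxA mulmxV// mul1mx.
Qed.

Lemma invmx_mul_neq0 W s : W \in unitmx -> s != 0 -> invmx W *m s != 0.
Proof.
move=> Wu; apply: contra_neq => h.
by rewrite -[s]mul1mx -(mulmxV Wu) -mulmxA h mulmx0.
Qed.

(** Since X V = I, u - V u = (X - I)(V u) has norm at most e |V u|; with e <= 1/2 this first gives
    |V u| <= 2 |u|. *)
Lemma opb_near1_inv (X V : 'M[R]_n) (e : R) : 0 <= e -> e <= 1 / 2 ->
  X *m V = 1%:M -> opb (X - 1%:M) e -> opb V 2 /\ opb (V - 1%:M) (2 * e).
Proof.
move=> e0 e1 XV Xe.
have h u : euclid (u - V *m u) <= e * euclid (V *m u).
  have := Xe (V *m u); rewrite mulmxBl mulmxA XV !mul1mx; exact.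
have V2 u : euclid (V *m u) <= 2 * euclid u.
  have H : euclid (V *m u) <= euclid u + e * euclid (V *m u).
    rewrite {1}(_ : V *m u = u + - (u - V *m u)); last by rewrite opprB addrC subrK.
    by apply: le_trans (euclidD _ _) _; rewrite lerD2l euclidN.
  have H2 : e * euclid (V *m u) <= 1 / 2 * euclid (V *m u).
    by rewrite ler_wpM2r ?euclid_ge0.
  by lra.
split => // u; rewrite mulmxBl mul1mx -euclidN opprB.
by apply: le_trans (h u) _; rewrite -mulrA mulrCA ler_wpM2l.
Qed.

(** The difference is, up to sign, ((y - z) + r y) / <y, z> with |r| <= e and <y, z> >= 1/2, hence
    at most 2 e times 2. *)
Lemma normalized_close (y z : 'cV[R]_n) (e : R) : euclid y = 1 -> e <= 1 / 2 ->
  euclid (y - z) <= e -> euclid ((dot y z)^-1 *: z - y) <= 4 * e.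
Proof.
move=> y1 e1 yz; pose r := dot y z - 1.
have yy : dot y y = 1 by rewrite dotvv y1 expr1n.
have re : `|r| <= e.
  have -> : r = - dot y (y - z).
    have dN : dot y (- z) = - dot y z by rewrite /dot mulmxN mxE.
    by rewrite dotDr yy dN opprD opprK addrC.
  by rewrite normrN; apply: le_trans (le_dot _ _) _; rewrite y1 mul1r.
have e0 : 0 <= e by exact: le_trans (normr_ge0 _) re.
have dE : dot y z = 1 + r by rewrite /r addrC subrK.
have d2 : 1 / 2 <= dot y z by move: re; rewrite dE ler_norml => /andP[]; lra.
have dgt : 0 < dot y z by lra.
have -> : (dot y z)^-1 *: z - y = (dot y z)^-1 *: - ((y - z) + r *: y).
  have -> : y - z + r *: y = dot y z *: y - z by rewrite dE scalerDl scale1r addrAC.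
  by rewrite opprB scalerBr scalerA mulVf ?gt_eqF// scale1r.
rewrite euclidZ euclidN ger0_norm ?invr_ge0 ?(ltW dgt)// mulrC ler_pdivrMr//.
apply: le_trans (euclidD _ _) _; rewrite euclidZ y1 mulr1.
have : 4 * e * (1 / 2) <= 4 * e * dot y z by rewrite ler_wpM2l// mulr_ge0.
lra.
Qed.

(** Let y be the unit vector along Ws^-1 s, V = W^-1 Ws and G = V^T V. The two matrices are I - y (G
    y / <y, G y>)^T and I - y y^T: the length of [s] cancels and only the distance of G from I
    matters, so [d] does not depend on [s]. *)
Lemma secant_factor_close (Ws : 'M[R]_n) (e : R) : Ws \in unitmx -> 0 < e ->
  exists2 d, 0 < d & forall W s, W \in unitmx -> s != 0 ->
    (forall i j, `|W i j - Ws i j| <= d) ->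
    opb (invmx Ws *m secant_factor W s *m Ws - proj_factor Ws s) e.
Proof.
move=> Wsu e0; have [b b0 bP] := opb_ex (invmx Ws).
(* |G - I| <= 6 t, and [normalized_close] needs 6 t <= 1/2 and returns 24 t, which must not exceed
   [e]. *)
pose t := Num.min (1 / 12) (e / 24).
have t0 : 0 < t by rewrite lt_min !divr_gt0.
have te : 24 * t <= e by rewrite mulrC -ler_pdivlMr// ge_min lexx orbT.
have t12 : t <= 1 / 12 by rewrite ge_min lexx.
(* Makes b n d <= t; the added ones keep the denominator positive when [b] or [n] is 0. *)
pose d := t / ((b + 1) * (n%:R + 1)).
have B1 : 0 < b + 1 by rewrite ltr_wpDl.
have N1 : 0 < (n%:R : R) + 1 by rewrite ltr_wpDl.
have d0 : 0 < d by rewrite divr_gt0 ?mulr_gt0.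
exists d => // W s Wu s0 Wd.
have bnd : b * (n%:R * d) <= t.
  have -> : b * (n%:R * d) = t * (b * n%:R) / ((b + 1) * (n%:R + 1)).
    by rewrite /d; ring.
  rewrite ler_pdivrMr ?mulr_gt0// ler_wpM2l ?(ltW t0)//.
  by rewrite ler_pM// ?lerDl.
pose V := invmx W *m Ws; pose X := invmx Ws *m W.
have XV : X *m V = 1%:M.
  by rewrite /X /V !mulmxA -[_ *m W *m _]mulmxA mulmxV// mulmx1 mulVmx.
have Xt : opb (X - 1%:M) t.
  apply: opb_le bnd _; rewrite -(mulVmx Wsu) -mulmxBr; apply: opb_mul => //.
  by apply: opb_entries; [exact: ltW|move=> i j; rewrite !mxE; exact: Wd].
have [||V2 V1] := opb_near1_inv _ _ XV Xt; [exact: ltW|lra|].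
pose G := V^T *m V.
have G1 : opb (G - 1%:M) (6 * t).
  have -> : G - 1%:M = V^T *m (V - 1%:M) + (V - 1%:M)^T.
    by rewrite mulmxBr mulmx1 linearB /= tr_scalar_mx addrA subrK.
  apply: (@opb_le _ _ _ (2 * (2 * t) + 2 * t)); first lra.
  apply: opb_add; last by apply: opb_tr => //; rewrite mulr_ge0// ltW.
  by apply: opb_mul => //; exact: opb_tr.
pose a := invmx Ws *m s; have a0 : a != 0 by exact: invmx_mul_neq0.
have agt : 0 < euclid a by rewrite lt_def euclid_eq0 a0 euclid_ge0.
have [y y1 aE] : exists2 y, euclid y = 1 & a = euclid a *: y.
  exists ((euclid a)^-1 *: a); last by rewrite scalerA mulfV ?gt_eqF// scale1r.
  by rewrite euclidZ ger0_norm ?invr_ge0 ?(ltW agt)// mulVf// gt_eqF.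
have Gy : euclid (y - G *m y) <= 6 * t.
  have := G1 y; rewrite y1 mulr1 mulmxBl mul1mx -euclidN opprB; exact.
have sE : invmx W *m s = euclid a *: (V *m y).
  by rewrite scalemxAr -aE /V /a -mulmxA (mulmxA Ws) mulmxV// mul1mx.
have dZ (c : R) (u v : 'cV[R]_n) : dot (c *: u) (c *: v) = c ^+ 2 * dot u v.
  by rewrite /dot trmxZ -scalemxAl -scalemxAr !mxE mulrA expr2.
have sc : euclid a ^+ 2 != 0 by rewrite expf_neq0// gt_eqF.
have outerZ (c q : R) (u v : 'cV[R]_n) :
    (c *: u) *m (q *: (c *: v))^T = c ^+ 2 * q *: (u *m v^T).
  rewrite !trmxZ -scalemxAl -!scalemxAr !scalerA; congr (_ *: _).
  by ring.
have H1 : invmx Ws *m secant_factor W s *m Ws =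
    1%:M - y *m ((dot y (G *m y))^-1 *: (G *m y))^T.
  rewrite mulmxBr mulmxBl mulmx1 mulVmx//; congr (_ - _).
  have covE : Ws^T *m secant_covector W s =
      ((euclid a ^+ 2 * dot y (G *m y))^-1 * euclid a) *: (G *m y).
    rewrite /secant_covector sE dZ -!scalemxAr scalerA.
    rewrite (_ : dot y (G *m y) = dot (V *m y) (V *m y)); last first.
      by rewrite /G -mulmxA dot_mulmx trmxK.
    by rewrite /G /V trmx_mul !mulmxA.
  rewrite mulmxA -/a -mulmxA -[X in _ *m X]trmxK trmx_mul trmxK covE.
  rewrite {1}aE trmxZ -scalemxAl -scalemxAr scalerA trmxZ -scalemxAr; congr (_ *: _).
  by rewrite mulrCA -expr2 invfM mulrAC mulVf// mul1r.
have H2 : proj_factor Ws s = 1%:M - y *m y^T.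
  rewrite proj_factorE -/a /line_proj dotvv; congr (_ - _).
  by rewrite {2 3}aE trmxZ -scalemxAl -scalemxAr !scalerA -mulrA -expr2 mulVf// scale1r.
have E : invmx Ws *m secant_factor W s *m Ws - proj_factor Ws s =
    - (y *m ((dot y (G *m y))^-1 *: (G *m y) - y)^T).
  by rewrite H1 H2 trmxB mulmxBr opprB addrC addrA subrK opprB.
rewrite E; apply: opb_opp; apply: opb_le te _.
apply: opb_le (opb_rank1 _ y1); apply: (@le_trans _ _ (4 * (6 * t))); last lra.
by apply: normalized_close => //; lra.
Qed.

End Projections.

(** * Contraction over blocks of steps, and the least-change update *)

Section Sequences.
Variable R : realType.

(** With error (1 - c) e / 2, the shifted sequence b = a - e / 2 satisfies b_{k+m} <= c b_k, so it
    is bounded by a geometric decay along each residue class modulo [m]. *)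
Lemma contraction_seq (a : nat -> R) (m : nat) (c : R) : 0 <= c -> c < 1 ->
  (forall e, 0 < e -> exists K, forall k, (K <= k)%N -> a (k + m)%N <= c * a k + e) ->
  forall e, 0 < e -> exists K, forall k, (K <= k)%N -> a k <= e.
Proof.
move=> c0 c1 H e e0; have e20 : 0 < e / 2 by rewrite divr_gt0.
have c1' : 0 < 1 - c by rewrite subr_gt0.
have [K HK] := H ((1 - c) * (e / 2)) (mulr_gt0 c1' e20).
pose b k := a k - e / 2.
have Hb k : (K <= k)%N -> b (k + m)%N <= c * b k.
  move=> /HK h; rewrite /b lerBlDr; apply: le_trans h _.
  by rewrite le_eqVlt; apply/orP; left; apply/eqP; ring.
have Hq q k : (K <= k)%N -> b (k + q * m)%N <= c ^+ q * b k.
  move=> Kk; elim: q => [|q ih]; first by rewrite mul0n addn0 mul1r.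
  rewrite mulSnr addnA; apply: le_trans (Hb _ (leq_trans Kk (leq_addr _ _))) _.
  by rewrite exprS -mulrA ler_wpM2l.
(* For m = 0 there are no residue classes, but b_k <= c b_k with c < 1 already gives b_k <= 0. *)
case: (posnP m) => [m0|m0].
  exists K => k Kk; have := Hb k Kk; rewrite m0 addn0.
  have [b0|b0] := leP (b k) 0; first by move=> _; move: b0; rewrite /b; lra.
  by move=> h; have := gtr_pMl c b0; rewrite c1 ltNge h.
(* One bound for the starting values of all [m] residue classes. *)
pose B := \sum_(r < m) `|b (K + r)%N|.
have B0 : 0 <= B by apply: sumr_ge0.
have [q0 Hq0] : exists q0, forall q, (q0 <= q)%N -> c ^+ q * B <= e / 2.
  have : (fun q => c ^+ q * B) @ \oo --> 0 * B.
    by apply: cvgM; [apply: cvg_expr; rewrite ger0_norm|exact: cvg_cst].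
  rewrite mul0r => /cvgrPdist_le/(_ _ e20)[q0 _ Hq0]; exists q0 => q /Hq0.
  by rewrite sub0r normrN ger0_norm// mulr_ge0 ?exprn_ge0.
exists (K + q0 * m)%N => k Kk.
pose q := ((k - K) %/ m)%N; pose r := ((k - K) %% m)%N.
have rm : (r < m)%N by rewrite ltn_mod.
have kE : k = (K + r + q * m)%N.
  by rewrite -addnA [(r + _)%N]addnC -divn_eq subnKC// (leq_trans _ Kk)// leq_addr.
have qq : (q0 <= q)%N by rewrite leq_divRL// leq_subRL// (leq_trans _ Kk)// leq_addr.
have := Hq q (K + r)%N (leq_addr _ _); rewrite -kE => h1.
have h2 : c ^+ q * b (K + r)%N <= c ^+ q * B.
  rewrite ler_wpM2l ?exprn_ge0// /B (bigD1 (Ordinal rm))//= -[leLHS]addr0.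
  by rewrite lerD ?ler_norm// sumr_ge0.
have := le_trans h1 (le_trans h2 (Hq0 q qq)); rewrite /b; lra.
Qed.

Variable n : nat.
Implicit Types A B : nat -> 'M[R]_n.

Lemma mxprodS A k m : mxprod A k m.+1 = A k *m mxprod A k.+1 m.
Proof. by []. Qed.

Lemma opb_mxprod A (s : R) K m : 0 <= s -> (forall k, (K <= k)%N -> opb (A k) s) ->
  forall k, (K <= k)%N -> opb (mxprod A k m) (s ^+ m).
Proof.
move=> s0 As; elim: m => [|m ih] k Kk; first exact: opb1.
rewrite mxprodS exprS; apply: opb_mul => //; first exact: As.
exact: ih (leqW Kk).
Qed.

(** Telescoping: A A' - B B' = (A - B) A' + B (A' - B'), with A' bounded by s^m and B by 1. *)
Lemma mxprod_close A B (s : R) K m : 0 <= s ->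
  (forall k, (K <= k)%N -> opb (A k) s) -> (forall k, (K <= k)%N -> opb (B k) 1) ->
  (forall e, 0 < e -> exists K', forall k, (K' <= k)%N -> opb (A k - B k) e) ->
  forall e, 0 < e -> exists K', forall k, (K' <= k)%N ->
    opb (mxprod A k m - mxprod B k m) e.
Proof.
move=> s0 As B1 AB; elim: m => [|m ih] e e0.
  exists 0%N => k _ v; rewrite /mxprod /= subrr mul0mx.
  have -> : euclid (0 : 'cV[R]_n) = 0 by apply/eqP; rewrite euclid_eq0.
  by rewrite mulr_ge0 ?euclid_ge0// ltW.
have e20 : 0 < e / 2 by rewrite divr_gt0.
have S1 : 0 < s ^+ m + 1 by rewrite ltr_wpDl ?exprn_ge0.
have d0 : 0 < e / 2 / (s ^+ m + 1) by rewrite divr_gt0.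
have [K1 H1] := AB _ d0; have [K2 H2] := ih _ e20.
exists (maxn K (maxn K1 K2)) => k; rewrite !geq_max => /and3P[Kk K1k K2k].
rewrite !mxprodS.
have -> : A k *m mxprod A k.+1 m - B k *m mxprod B k.+1 m =
   (A k - B k) *m mxprod A k.+1 m + B k *m (mxprod A k.+1 m - mxprod B k.+1 m).
  by rewrite mulmxBl mulmxBr addrA subrK.
apply: (@opb_le _ _ _ (e / 2 / (s ^+ m + 1) * s ^+ m + 1 * (e / 2))).
  rewrite mul1r [leRHS]splitr lerD2r -mulrA ler_piMr ?(ltW e20)//.
  by rewrite mulrC ler_pdivrMr// mul1r lerDl.
apply: opb_add; apply: opb_mul; rewrite ?(ltW d0)//.
- exact: H1.
- exact: (opb_mxprod _ s0 As (leqW Kk)).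
- exact: B1.
- exact/H2/leqW.
Qed.

End Sequences.

(** * Tensor sequences tending to zero *)

Section NullTensors.
Variables (R : realType) (n p : nat).
Notation tensor := (tensor R n p).

Definition vanish (T : nat -> tensor) :=
  forall e, 0 < e -> exists K, forall k, (K <= k)%N -> frob (T k) <= e.

Lemma vanish_le (T U : nat -> tensor) (c : R) K : 0 <= c -> vanish T ->
  (forall k, (K <= k)%N -> frob (U k) <= c * frob (T k)) -> vanish U.
Proof.
move=> c0 Tv UT e e0; have c1 : 0 < c + 1 by rewrite ltr_wpDl.
have [K' HK] := Tv _ (divr_gt0 e0 c1).
exists (maxn K K') => k; rewrite geq_max => /andP[Kk K'k].
apply: le_trans (UT k Kk) _; apply: le_trans (ler_wpM2l c0 (HK k K'k)) _.
by rewrite mulrCA ler_piMr ?(ltW e0)// ler_pdivrMr// mul1r lerDl.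
Qed.

Lemma vanishD (T U : nat -> tensor) : vanish T -> vanish U ->
  vanish (fun k => tadd (T k) (U k)).
Proof.
move=> Tv Uv e e0; have e20 : 0 < e / 2 by rewrite divr_gt0.
have [K1 H1] := Tv _ e20; have [K2 H2] := Uv _ e20.
exists (maxn K1 K2) => k; rewrite geq_max => /andP[K1k K2k].
apply: le_trans (frobD _ _) _; rewrite [e]splitr lerD//; [exact: H1|exact: H2].
Qed.

Lemma vanish_shift (T : nat -> tensor) : vanish T -> vanish (fun k => T k.+1).
Proof.
by move=> Tv e /Tv[K HK]; exists K => k Kk; apply: HK; exact: leqW.
Qed.

Lemma vanish_entries (T : nat -> tensor) :
  (forall idx, (fun k => T k idx) @ \oo --> (0 : R)) -> vanish T.
Proof.
move=> T0 e e0.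
have sq_cvg : (fun k => \sum_idx T k idx ^+ 2) @ \oo --> (0 : R).
  rewrite [X in _ --> X](_ : 0 = \sum_(idx : {ffun 'I_p -> 'I_n}) (0 : R) * 0); last first.
    by rewrite big1// => k _; rewrite mul0r.
  apply: cvg_big => [|idx _]; last by apply: cvgM; exact: T0.
  exact: add_continuous.
have e2 : 0 < e ^+ 2 by rewrite exprn_gt0.
have /cvgrPdist_le/(_ _ e2)[K _ HK] := sq_cvg; exists K => k /HK.
rewrite sub0r normrN ger0_norm ?sqsum_ge0// => h.
by rewrite -[leRHS]ger0_norm ?(ltW e0)// -sqrtr_sqr ler_wsqrtr.
Qed.

(** Induction on [m], peeling off the first step: its error passes through the remaining [m]
    congruences, which enlarge it by at most (s^m)^p. [mxprod] puts the earliest factor leftmost, as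
    T[A][B] = T[A B] requires. *)
Lemma vanish_product (F : nat -> tensor) (N : nat -> 'M[R]_n) K (s : R) m :
  0 <= s -> (forall k, (K <= k)%N -> opb (N k) s) ->
  vanish (fun k => tsub (F k.+1) (tcongr (F k) (N k))) ->
  vanish (fun k => tsub (F (k + m)%N) (tcongr (F k) (mxprod N k m))).
Proof.
move=> s0 Ns H; elim: m => [|m ih].
  move=> e e0; exists 0%N => k _; rewrite addn0 tcongr1 /frob big1 ?sqrtr0 ?(ltW e0)//.
  by move=> i _; rewrite /tsub subrr expr0n.
have H' : vanish (fun k => tcongr (tsub (F k.+1) (tcongr (F k) (N k))) (mxprod N k.+1 m)).
  apply: (@vanish_le _ _ ((s ^+ m) ^+ p) K _ H) => [|k Kk].
    by rewrite !exprn_ge0.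
  apply: frob_tcongr; first exact: exprn_ge0.
  exact: (opb_mxprod _ s0 Ns (leqW Kk)).
have E k : tsub (F (k + m.+1)%N) (tcongr (F k) (mxprod N k m.+1)) =
   tadd (tsub (F (k.+1 + m)%N) (tcongr (F k.+1) (mxprod N k.+1 m)))
        (tcongr (tsub (F k.+1) (tcongr (F k) (N k))) (mxprod N k.+1 m)).
  rewrite mxprodS -tcongrM tcongr_sub addnS addSn.
  by apply/funext => i; rewrite /tadd /tsub addrA subrK.
by move=> e /(vanishD (vanish_shift ih) H')[K' HK']; exists K' => k /HK'; rewrite E.
Qed.

End NullTensors.

(** * Optimality of the least-change update *)

Section LeastChange.
Variables (R : realType) (n p : nat).
Notation tensor := (tensor R n p).
Implicit Types (T U : tensor) (s : 'cV[R]_n) (W : 'M[R]_n).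

Lemma teval_fix0 (j0 : 'I_p) T A s v : val j0 = 0%N -> A *m s = 0 ->
  teval (tcongr T A) (fix_first s v) = 0.
Proof.
move=> j00 As; rewrite teval_tcongr /teval big1// => k _.
by rewrite (bigD1 j0)//= /fix_first j00 eqxx As mxE mul0r mulr0.
Qed.

(** The competitor is T' - Y with Y = Z[Q W^-1]: it is symmetric, and feasible because Q W^-1 s = 0.
    Its weighted distance to [T] is |Z - Z[Q]|, so minimality forces Z[Q] = 0, and a congruence by
    W^-1 concludes. *)
Lemma least_change (j0 : 'I_p) T T' D s W : val j0 = 0%N ->
  W \in unitmx -> s != 0 -> tsym T -> tsym T' -> tcontr_eq T' D s ->
  (forall U, tsym U -> tcontr_eq U D s ->
     frob (tcongr (tsub T' T) W) <= frob (tcongr (tsub U T) W)) ->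
  tcongr T' (secant_factor W s) = tcongr T (secant_factor W s).
Proof.
move=> j00 Wu s0 Ts T's T'D min.
pose Z := tcongr (tsub T' T) W; pose Q := line_proj (invmx W *m s).
have y0 := invmx_mul_neq0 Wu s0.
have Zs : tsym Z by apply/tsym_tcongr/tsym_tsub.
pose Y := tcongr Z (Q *m invmx W).
have QWs : Q *m invmx W *m s = 0 by rewrite -mulmxA line_proj0.
have YW : tcongr Y W = tcongr Z Q by rewrite /Y tcongrM -mulmxA mulVmx// mulmx1.
have U_min : frob Z <= frob (tsub Z (tcongr Z Q)).
  rewrite (_ : tsub Z (tcongr Z Q) = tcongr (tsub (tsub T' Y) T) W); last first.
    by rewrite -YW /Z !tcongr_sub; apply/funext => i; rewrite /tsub addrAC.
  apply: min; first by apply: tsym_tsub => //; exact: tsym_tcongr.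
  move=> v; rewrite teval_tsub T'D.
  by rewrite (teval_fix0 _ _ j00 QWs) subr0.
have Z0 := tcongr_proj_eq0 (line_proj_tr _) (line_proj_idem y0) U_min.
apply: tsub0P => i; rewrite -tcongr_sub secant_factorE// -2!tcongrM.
rewrite tcongrE /tmul big1// => k _; rewrite -/Z Z0 mul0r//.
Qed.

Lemma secant_update (j0 : 'I_p) T T' D s W : val j0 = 0%N ->
  W \in unitmx -> s != 0 -> tsym D -> tsym T -> tsym T' -> tcontr_eq T' D s ->
  (forall U, tsym U -> tcontr_eq U D s ->
     frob (tcongr (tsub T' T) W) <= frob (tcongr (tsub U T) W)) ->
  tsub T' D = tcongr (tsub T D) (secant_factor W s).
Proof.
move=> j00 Wu s0 Ds Ts T's T'D min.
rewrite tcongr_sub -(least_change j00 Wu s0 Ts T's T'D min) -tcongr_sub.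
rewrite /secant_factor (tcongr_fix _ j00)//; first exact: tsym_tsub.
by move=> v; rewrite teval_tsub T'D subrr.
Qed.

End LeastChange.

Theorem mainTheorem8 (R : realType) (n p : nat) (f : 'cV[R]_n -> R)
  (x : nat -> 'cV[R]_n) (W : nat -> 'M[R]_n) (C : nat -> tensor R n p)
  (xs : 'cV[R]_n) (Ws : 'M[R]_n) :
  (2 <= p)%N ->
  Cp p f ->
  (forall k, x k.+1 - x k != 0) ->
  (forall k, W k \in unitmx) ->
  tsym (C 0%N) ->
  (forall k,
     tsym (C k.+1) /\
     tcontr_eq (C k.+1) (Dp_avg f (x k) (x k.+1 - x k)) (x k.+1 - x k) /\
     (forall C' : tensor R n p, tsym C' ->
        tcontr_eq C' (Dp_avg f (x k) (x k.+1 - x k)) (x k.+1 - x k) ->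
        frob (tcongr (tsub (C k.+1) (C k)) (W k))
          <= frob (tcongr (tsub C' (C k)) (W k)))) ->
  x @ \oo --> xs ->
  W @ \oo --> Ws ->
  Ws \in unitmx ->
  (exists (m : nat) (c : R), 0 <= c /\ c < 1 /\
     exists K : nat, forall k0 : nat, (K <= k0)%N ->
       spec_norm (mxprod (fun k => proj_factor Ws (x k.+1 - x k)) k0 m) <= c) ->
  forall idx : {ffun 'I_p -> 'I_n},
    (fun k => C k idx) @ \oo --> Dp f xs idx.
Proof.
  move=> p2 fCp s0 Wu C0s Cmin xxs WWs Wsu [m [c [c0 [c1 [K0 HK0]]]]].
  have p0 : (0 < p)%N := ltnW p2.
  pose j0 : 'I_p := Ordinal p0; have j00 : val j0 = 0%N by [].
  have Csym k : tsym (C k) by case: k => [//|k]; have [] := Cmin k.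
  pose s k := x k.+1 - x k; have sk0 k : s k != 0 := s0 k.
  pose Dstar : tensor R n p := Dp f xs.
  pose D k : tensor R n p := Dp_avg f (x k) (s k).
  pose F k := tcongr (tsub (C k) Dstar) Ws.
  pose H k := tcongr (tsub (D k) Dstar) Ws.
  pose N k := invmx Ws *m secant_factor (W k) (s k) *m Ws.
  pose P k := proj_factor Ws (s k).
  have [b b0 bP] := opb_ex Ws.
  have [b' b'0 b'P] := opb_ex (invmx Ws).
  have H_vanish : vanish H.
    have D_vanish : vanish (fun k => tsub (D k) Dstar).
      apply: vanish_entries => idx.
      have Dcvg := Rintegral_segment_cvg (Dp_continuous fCp (idx := idx)) xxs.
      by rewrite -(subrr (Dstar idx)); apply: cvgB; [exact: Dcvg|exact: cvg_cst].
    apply: (@vanish_le _ _ _ _ _ (b ^+ p) 0%N _ D_vanish) => [|k _].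
      exact: exprn_ge0.
    exact: frob_tcongr.
  (* The exact recursion F_{k+1} - H_k = (F_k - H_k)[N_k], rearranged so that the right side tends
     to 0 with [H]. *)
  have FN k : tsub (F k.+1) (tcongr (F k) (N k)) = tsub (H k) (tcongr (H k) (N k)).
    have [C's [C'D C'min]] := Cmin k.
    have U : tsub (C k.+1) (D k) = tcongr (tsub (C k) (D k)) (secant_factor (W k) (s k)).
      by apply: (secant_update j00 (Wu k) (sk0 k)) => //; exact: Dp_avg_sym.
    have MN : secant_factor (W k) (s k) *m Ws = Ws *m N k.
      by rewrite /N !mulmxA mulmxV// mul1mx.
    have := congr1 (fun T => tcongr T Ws) U; rewrite tcongrM MN -tcongrM.
    rewrite !tcongr_sub => V; apply/funext => i.
    have := congr1 (fun T => T i) V; rewrite /tsub /F /H !tcongr_sub /tsub /=; lra.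
  have NP_close e : 0 < e -> exists K, forall k, (K <= k)%N -> opb (N k - P k) e.
    move=> e0; have [d d0 Hd] := secant_factor_close Wsu e0.
    have /cvg_ballP/(_ d d0)[K _ HK] := WWs; exists K => k /HK [_ WB].
    apply: Hd => // i j; rewrite distrC; exact/ltW/WB.
  have P1 k : opb (P k) 1.
    by rewrite /P proj_factorE; exact/opb_line_proj/invmx_mul_neq0.
  have [K1 N2] : exists K, forall k, (K <= k)%N -> opb (N k) 2.
    have [K HK] := NP_close 1 ltr01; exists K => k /HK NP.
    by rewrite -(subrK (P k) (N k)); apply: opb_add.
  have FN_vanish : vanish (fun k => tsub (F k.+1) (tcongr (F k) (N k))).
    apply: (@vanish_le _ _ _ _ _ (1 + 2 ^+ p) K1 _ H_vanish) => [|k Kk].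
      by rewrite addr_ge0 ?exprn_ge0.
    rewrite FN; apply: le_trans (frobB _ _) _; rewrite mulrDl mul1r lerD2l.
    exact/frob_tcongr/N2.
  have Fm_vanish := vanish_product m (ler0n R 2) N2 FN_vanish.
  (* The midpoint of [c] and 1: the gap c2 - c absorbs the error of replacing the product of the
     [P k] by that of the [N k]. *)
  pose c2 := (1 + c) / 2.
  have [c20 c21 cc2] : [/\ 0 <= c2, c2 < 1 & 0 < c2 - c] by rewrite /c2; split; lra.
  have [K2 HK2] := mxprod_close m (ler0n R 2) N2 (fun k _ => P1 k) NP_close cc2.
  have F_vanish e : 0 < e -> exists K, forall k, (K <= k)%N -> frob (F k) <= e.
    apply: (contraction_seq (m := m) c20 c21) => {}e e0.
    have [K3 HK3] := Fm_vanish e e0.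
    exists (maxn K0 (maxn K2 K3)) => k; rewrite !geq_max => /and3P[K0k K2k K3k].
    have opN : opb (mxprod N k m) c2.
      rewrite -(subrK (mxprod P k m) (mxprod N k m)) -(subrK c c2).
      apply: opb_add; first exact: HK2.
      exact: opb_le (HK0 k K0k) (opb_spec_norm _).
    rewrite (_ : F (k + m)%N = tadd (tcongr (F k) (mxprod N k m))
        (tsub (F (k + m)%N) (tcongr (F k) (mxprod N k m)))); last first.
      by apply/funext => i; rewrite /tadd /tsub addrC subrK.
    apply: le_trans (frobD _ _) _; apply: lerD; last exact: HK3.
    apply: le_trans (frob_tcongr _ c20 opN) _; rewrite ler_wpM2r ?frob_ge0//.
    (* c2^p <= c2, since p >= 1 and 0 <= c2 <= 1. *)
    by rewrite -(prednK p0) exprS ler_piMr// exprn_ile1// ltW.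
  (* A congruence by Ws^-1 undoes the change of coordinates at the bounded cost b'^p. *)
  have E_vanish : vanish (fun k => tsub (C k) Dstar).
    apply: (@vanish_le _ _ _ F _ (b' ^+ p) 0%N _ F_vanish) => [|k _].
      exact: exprn_ge0.
    rewrite -[tsub _ _]tcongr1 -(mulmxV Wsu) -tcongrM; exact: frob_tcongr.
  move=> idx; apply/cvgrPdist_le => e e0; have [K HK] := E_vanish e e0.
  exists K => // k Kk; rewrite distrC.
  exact: le_trans (entry_le_frob _ idx) (HK k Kk).
Qed.
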